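(* Let $m \geq 1$ be an integer, let $k$ be a prime number, let $q=p^{km}$ with $p$ prime and $q \equiv 1 \bmod 2k$, and let $\mathcal{P}(q,k)=(V,E)$ be the generalized Paley graph of order $q$ with $k$-th powers. Then the condensed Ricci curvature satisfies $$\Bbbk(x,y) = \frac{k}{q-1}\left(2 + \vert \nabla_{xy} \vert\right)$$ for any edge $xy \in E$.
   Context: For an integer $k\ge 2$ and a finite field $\mathbb{F}_q$ of order $q=p^n$ with $q \equiv 1 \bmod 2k$, let $(\mathbb{F}_q^{\times})^k=\{\alpha\in\mathbb{F}_q^\times \mid \alpha=\beta^k \text{ for some } \beta\in\mathbb{F}_q^\times\}$. The generalized Paley graph $\mathcal{P}(q,k)$ is the simple undirected graph with vertex set $\mathbb{F}_q$ in which $x,y$ are adjacent if and only if $x-y\in(\mathbb{F}_q^\times)^k$. (The congruence guarantees $q$ is odd and $-1\in(\mathbb{F}_q^\times)^k$.) For a vertex $v$ of a locally finite simple graph $G=(V,E)$, $\Gamma(v)=\{w\in V\mid vw\in E\}$, and for an edge $xy\in E$, $\nabla_{xy}=\Gamma(x)\cap\Gamma(y)$. Condensed Ricci curvature (the modification of Ollivier's coarse Ricci curvature due to Lin, Lu and Yau): let $G=(V,E)$ be a connected, locally finite, undirected, simple graph with shortest path distance $\rho$. For $x\in V$ and $0<\varepsilon\le 1$ let $m_x^\varepsilon$ be the probability measure on $V$ with $m_x^\varepsilon(x)=1-\varepsilon$, $m_x^\varepsilon(v)=\varepsilon/|\Gamma(x)|$ for $v\in\Gamma(x)$, and $m_x^\varepsilon(v)=0$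 otherwise. For finitely supported probability measures $\mu,\nu$ on $V$ let $W(\mu,\nu)=\inf_{\pi}\sum_{u,v\in V}\rho(u,v)\pi(u,v)$ be the $1$-Wasserstein (transport) distance, the infimum being over all couplings $\pi$ of $\mu$ and $\nu$. For distinct $x,y\in V$ put $\Bbbk_\varepsilon(x,y)=1-\dfrac{W(m_x^\varepsilon,m_y^\varepsilon)}{\rho(x,y)}$ and define the condensed Ricci curvature $\Bbbk(x,y)=\lim_{\varepsilon\to0^+}\dfrac{\Bbbk_\varepsilon(x,y)}{\varepsilon}$. *)

(* Defs.v *)
From HB Require Import structures.
From mathcomp Require Import all_boot all_order all_algebra.
From mathcomp Require Import all_classical all_reals all_analysis.

Set Implicit Arguments.
Unset Strict Implicit.
Unset Printing Implicit Defensive.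

Import Order.TTheory GRing.Theory Num.Theory.
Import numFieldNormedType.Exports.

Local Open Scope ring_scope.
Local Open Scope classical_set_scope.

(* A finite simple graph is given by its adjacency relation [e : rel T].  The
   definitions below are meant for symmetric, irreflexive, connected [e]; the
   curvature is only needed for finite graphs, so the vertices form a finType
   and every measure is finitely supported. *)
Section Graph.
Variables (T : finType) (e : rel T).

Definition neighbors (x : T) : {set T} := [set v | e x v]%SET.

Definition common_neighbors (x y : T) : {set T} :=
  (neighbors x :&: neighbors y)%SET.

Definition has_walk (x y : T) (n : nat) : bool :=
  [exists s : n.-tuple T, path e x s && (last x s == y)].

(* The least length of a walk from x to y: a shortest walk has fewer than #|T|
   edges.  The value is the junk #|T| when x and y are not connected. *)
Definition graph_dist (x y : T) : nat := find (has_walk x y) (iota 0 #|T|).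

End Graph.

Section Curvature.
Variables (R : realType) (T : finType) (e : rel T).

Definition lazy_measure (eps : R) (x v : T) : R :=
  if v == x then 1 - eps
  else if v \in neighbors e x then eps / #|neighbors e x|%:R
  else 0.

Definition coupling (mu nu : T -> R) (pi : T -> T -> R) : Prop :=
  [/\ forall u v, 0 <= pi u v,
      forall u, \sum_v pi u v = mu u
    & forall v, \sum_u pi u v = nu v].

Definition transport_cost (pi : T -> T -> R) : R :=
  \sum_u \sum_v (graph_dist e u v)%:R * pi u v.

Definition wasserstein (mu nu : T -> R) : R :=
  inf [set transport_cost pi | pi in [set pi | coupling mu nu pi]].

Definition eps_curvature (eps : R) (x y : T) : R :=
  1 - wasserstein (lazy_measure eps x) (lazy_measure eps y)
      / (graph_dist e x y)%:R.

(* [lim] is total: the value is meaningful only together with the convergence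
   of the quotient. *)
Definition condensed_ricci (x y : T) : R :=
  lim (eps_curvature eps x y / eps @[eps --> 0^'+]).

End Curvature.

Definition kth_powers (F : finFieldType) (k : nat) : {set F} :=
  [set b ^+ k | b in [set b : F | b != 0]]%SET.

Definition gen_paley (F : finFieldType) (k : nat) : rel F :=
  fun x y => x - y \in kth_powers F k.

(* Main.v *)
(* Put Q = p^m, d = (q - 1)/k and h = x - y.  As k is prime, Q = Q^k = 1 mod k,
   so k divides (q - 1)/(Q - 1) = 1 + Q + ... + Q^(k-1), and every nonzero
   element of the subfield K = {a | a^Q = a} is a k-th power in F.  Hence each
   coset of hK is a clique.  Translation by -h preserves these cosets and maps
   the closed neighbourhood B(x) onto B(y), so B(x) and B(y) meet each coset in
   equally many vertices: B(x) can be transported onto B(y) with B(x) /\ B(y)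
   fixed and every other unit of mass moved along one edge.  Since
   m_x^eps = (1 - eps - eps/d) 1_x + (eps/d) 1_B(x), this yields a coupling of
   cost 1 - eps (2 + t)/d, where t is the number of common neighbours; testing
   against the indicator of {x} \/ (B(x) \ B(y)) shows it is optimal. *)

Require Import Defs.
From mathcomp Require Import all_boot all_order all_algebra.
From mathcomp Require Import all_classical all_reals all_analysis.
From mathcomp Require Import all_solvable all_field ring lra.

Import Order.TTheory GRing.Theory Num.Theory.
Import numFieldNormedType.Exports.

Local Open Scope ring_scope.
Local Open Scope classical_set_scope.

(** * Transport between two finite sets inside the classes of an equivalence *)

Lemma sum_indic {R : realType} {T : finType} (P : pred T) :
  \sum_v (P v)%:R = #|P|%:R :> R.
Proof.
rewrite -sum1_card natr_sum [RHS]big_mkcond; apply: eq_bigr => v _.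
by rewrite unfold_in; case: (P v).
Qed.

Lemma sum_indicM {R : realType} {T : finType} (x : T) (f : T -> R) :
  \sum_v (v == x)%:R * f v = f x.
Proof.
rewrite (bigD1 x) //= eqxx mul1r big1 ?addr0 // => v /negPf ->.
by rewrite mul0r.
Qed.

(** Removing [X :&: Y] leaves equally many points of [X] and [Y] in each class. A fractional plan
    avoids choosing bijections class by class. *)
Lemma class_transport (R : realType) {T : finType} {r : rel T} {X Y : {set T}} :
  reflexive r -> symmetric r -> transitive r ->
  (forall u, #|[set v in X | r u v]%SET| = #|[set v in Y | r u v]%SET|) ->
  exists w : T -> T -> R,
    [/\ forall u v, 0 <= w u v,
        forall u, \sum_v w u v = (u \in X)%:R,
        forall v, \sum_u w u v = (v \in Y)%:R,
        forall u, w u u = (u \in X :&: Y)%SET%:R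
      & forall u v, ~~ r u v -> w u v = 0].
Proof.
move=> rr rs rt cXY.
pose n u := #|[set v in X :\: Y | r u v]%SET|.
have nE u : n u = #|[set v in Y :\: X | r u v]%SET|.
  have splitI (A B : {set T}) : #|[set v in A | r u v]%SET| =
      (#|[set v in A :&: B | r u v]%SET| + #|[set v in A :\: B | r u v]%SET|)%N.
    rewrite -(cardsID B); congr (_ + _)%N; apply: eq_card => v;
      rewrite !inE; by case: (v \in A); case: (v \in B); case: (r u v).
  apply/eqP; rewrite -(eqn_add2l #|[set v in X :&: Y | r u v]%SET|) -splitI.
  by rewrite cXY (splitI Y X) finset.setIC.
have n_class u v : r u v -> n u = n v.
  move=> ruv; apply: eq_card => z; rewrite !inE; congr (_ && _).
  by apply/idP/idP => [|/(rt _ _ _ ruv)//]; apply: rt; rewrite rs.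
have n_gt0 u : u \in (X :\: Y)%SET -> (n u)%:R != 0 :> R.
  move=> uA; rewrite pnatr_eq0 -lt0n; apply/card_gt0P; exists u.
  by rewrite inE uA rr.
(* Mass on X :&: Y stays; mass at u in X :\: Y is spread evenly over the part
   of Y :\: X in the class of u. *)
exists (fun u v => ((v == u) && (u \in X :&: Y)%SET)%:R +
   ([&& u \in (X :\: Y)%SET, v \in (Y :\: X)%SET & r u v])%:R / (n u)%:R).
split => [u v|u|v|u|u v nr].
- by apply: addr_ge0; rewrite ?divr_ge0 ?ler0n.
- rewrite /= big_split /= -mulr_suml.
  have -> : \sum_v ((v == u) && (u \in X :&: Y)%SET)%:R
           = (u \in X :&: Y)%SET%:R :> R.
    rewrite -[RHS](sum_indicM u (fun=> (u \in X :&: Y)%SET%:R)).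
    apply: eq_bigr => v _.
    by rewrite -mulnb natrM.
  have [uA|uA] /= := boolP (u \in (X :\: Y)%SET).
    rewrite sum_indic (_ : #|_| = n u); last first.
      by rewrite nE; apply: eq_card => v; rewrite [RHS]inE.
    rewrite divff ?n_gt0 //; move: uA; rewrite !inE.
    by case/andP=> /negPf -> ->; rewrite add0r.
  rewrite big1 // mul0r addr0; move: uA; rewrite !inE.
  by case: (u \in X); case: (u \in Y).
- rewrite /= big_split /=.
  have -> : \sum_u ((v == u) && (u \in X :&: Y)%SET)%:R
           = (v \in X :&: Y)%SET%:R :> R.
    rewrite -[RHS](sum_indicM v (fun=> (v \in X :&: Y)%SET%:R)).
    apply: eq_bigr => u _.
    by rewrite eq_sym -mulnb natrM; case: eqP => [->|]; rewrite ?mul0r.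
  have [vA|vA] /= := boolP (v \in (Y :\: X)%SET); last first.
    rewrite big1 => [|u _]; last by rewrite andbF mul0r.
    rewrite addr0; move: vA; rewrite !inE.
    by case: (v \in X); case: (v \in Y).
  (* [n] is constant on classes, so the denominator can be pulled out of the column sum. *)
  have -> : \sum_u ((u \in (X :\: Y)%SET) && r u v)%:R / (n u)%:R =
            \sum_u ((u \in (X :\: Y)%SET) && r v u)%:R / (n v)%:R :> R.
    apply: eq_bigr => u _; rewrite (rs v).
    by case ruv: (r u v); rewrite ?andbF ?mul0r // (n_class _ _ ruv).
  rewrite -mulr_suml sum_indic (_ : #|_| = n v); last first.
    by apply: eq_card => u; rewrite [RHS]inE.
  have nv0 : (n v)%:R != 0 :> R.
    by rewrite nE pnatr_eq0 -lt0n; apply/card_gt0P; exists v; rewrite inE vA rr.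
  rewrite divff //; move: vA; rewrite !inE.
  by case/andP=> /negPf -> ->; rewrite add0r.
- rewrite eqxx /= !inE.
  by case: (u \in X); case: (u \in Y); rewrite /= ?mul0r ?addr0.
- rewrite (negPf nr) !andbF mul0r addr0; case: eqP => // vu.
  by rewrite vu rr in nr.
Qed.

(** * Graph distances 0 and 1 *)

Section Graph.
Variables (T : finType) (e : rel T).

Lemma has_walk0 x y : has_walk e x y 0 = (x == y).
Proof.
apply/existsP/idP => [[s]|xy]; first by rewrite tuple0.
by exists [tuple].
Qed.

Lemma has_walk1 x y : has_walk e x y 1 = e x y.
Proof.
apply/existsP/idP => [[s]|xy].
  by case/tupleP: s => z s; rewrite tuple0 /= andbT => /andP[exz /eqP <-].
by exists [tuple y]; rewrite /= xy eqxx.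
Qed.

Lemma graph_dist_refl x : graph_dist e x x = 0%N.
Proof.
rewrite /graph_dist; case E: #|T| => [//|n] /=.
by rewrite has_walk0 eqxx.
Qed.

Lemma graph_dist_gt0 x y : x != y -> (0 < graph_dist e x y)%N.
Proof.
move=> xy; rewrite /graph_dist.
have: (0 < #|T|)%N by apply/card_gt0P; exists x.
by case: #|T| => [//|n] _ /=; rewrite has_walk0 (negPf xy).
Qed.

Lemma graph_dist_edge x y : x != y -> e x y -> graph_dist e x y = 1%N.
Proof.
move=> xy exy; rewrite /graph_dist.
(* Two distinct vertices put length 1 within the range that [find] searches. *)
have: (1 < #|T|)%N by rewrite (cardD1 x) (cardD1 y) !inE eq_sym xy.
by case: #|T| => [//|[//|n]] _ /=; rewrite has_walk0 has_walk1 (negPf xy) exy.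
Qed.

End Graph.

(** * Upper and lower bounds on the Wasserstein distance *)

Lemma wasserstein_eq {R : realType} {T : finType} {e : rel T}
    (mu nu : T -> R) (pi : T -> T -> R) (c : R) :
  coupling mu nu pi -> transport_cost e pi = c ->
  (forall pi', coupling mu nu pi' -> c <= transport_cost e pi') ->
  wasserstein e mu nu = c.
Proof.
move=> pic costE lb; apply/eqP; rewrite eq_le; apply/andP; split.
  (* The costs are bounded below by [c] and include that of [pi], so [inf] is a genuine infimum. *)
  apply: ge_inf; last by exists pi.
  by exists c => _ [pi' /= + <-]; apply: lb.
apply: lb_le_inf; first by exists c; exists pi.
by move=> _ [pi' /= + <-]; apply: lb.
Qed.

(* Kantorovich duality with the 1-Lipschitz test function [v \in C]. *)
Lemma transport_cost_ge {R : realType} {T : finType} (e : rel T) (C : {set T})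
    {mu nu : T -> R} {g : T -> T -> R} :
  coupling mu nu g ->
  \sum_(u in C) mu u - \sum_(v in C) nu v <= transport_cost e g.
Proof.
case=> pi0 gu gv.
have muE : \sum_(u in C) mu u = \sum_u \sum_v (u \in C)%:R * g u v.
  rewrite big_mkcond; apply: eq_bigr => u _; rewrite -mulr_sumr gu.
  by case: ifP; rewrite ?mul1r ?mul0r.
have nuE : \sum_(v in C) nu v = \sum_u \sum_v (v \in C)%:R * g u v.
  rewrite exchange_big /= big_mkcond; apply: eq_bigr => v _.
  by rewrite -mulr_sumr gv; case: ifP; rewrite ?mul1r ?mul0r.
rewrite muE nuE -sumrB; apply: ler_sum => u _.
rewrite -sumrB; apply: ler_sum => v _; rewrite -mulrBl ler_wpM2r //.
have [->|uv] := eqVneq u v; first by rewrite graph_dist_refl subrr.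
rewrite (@le_trans _ _ 1) ?ler1n ?graph_dist_gt0 //.
by case: (u \in C); case: (v \in C);
  rewrite ?subrr ?subr0 ?sub0r ?lexx ?ler01 ?lerN10.
Qed.

(** * Curvature of an edge when a partition into cliques balances the closed neighbourhoods *)

Section Curvature.
Variables (R : realType) (T : finType) (e r : rel T) (x y : T) (d : nat).
Hypothesis e_irr : irreflexive e.
Hypotheses (exy : e x y) (eyx : e y x).
Hypotheses (dx : #|neighbors e x| = d) (dy : #|neighbors e y| = d).
Hypotheses (rr : reflexive r) (rs : symmetric r) (rt : transitive r).
Hypothesis r_clique : forall u v, u != v -> r u v -> e u v.

Let B z := (z |: neighbors e z)%SET.

Hypothesis r_card :
  forall u, #|[set v in B x | r u v]%SET| = #|[set v in B y | r u v]%SET|.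

Let xy : x != y.
Proof. by apply: contraTneq exy => ->; rewrite e_irr. Qed.

Lemma lazy_measureE eps z v :
  lazy_measure e eps z v =
  (1 - eps - eps / #|neighbors e z|%:R) * (v == z)%:R
  + eps / #|neighbors e z|%:R * (v \in B z)%:R :> R.
Proof.
rewrite /lazy_measure !inE; case: eqP => [->|_] /=; first by ring.
by case: ifP => _ /=; ring.
Qed.

(** The two extra points are [x] and [y] themselves; they give the 2 in the curvature formula. *)
Lemma card_closed_neighborsI : #|B x :&: B y|%SET =
  (#|common_neighbors e x y|).+2.
Proof.
rewrite (_ : B x :&: B y = x |: (y |: common_neighbors e x y))%SET.
  by rewrite !cardsU1 !inE !e_irr exy (negPf xy) /= ?andbF.
apply/setP => z; rewrite !inE.
have [->|_] := eqVneq z x; first by rewrite eyx orbT.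
by have [->|_] := eqVneq z y; first by rewrite exy.
Qed.

Lemma card_closed_neighborsD :
  (#|B x :\: B y|%SET + #|common_neighbors e x y|.+1)%N = d.
Proof.
have := cardsID (B y) (B x); rewrite card_closed_neighborsI.
by rewrite cardsU1 inE e_irr dx add1n addnC addnS => -[].
Qed.

Let d_gt0 : (0 < d)%N.
Proof. by rewrite -card_closed_neighborsD addnS. Qed.

Lemma wasserstein_clique_partition (eps : R) : 0 <= eps -> eps <= 2^-1 ->
  wasserstein e (lazy_measure e eps x) (lazy_measure e eps y) =
  1 - eps * ((2 + #|common_neighbors e x y|%:R) / d%:R).
Proof.
move=> eps0 eps1.
set t := #|common_neighbors e x y|.
have dne0 : d%:R != 0 :> R by rewrite pnatr_eq0 -lt0n.
have DE : #|B x :\: B y|%SET%:R = d%:R - t%:R - 1 :> R.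
  by rewrite -card_closed_neighborsD natrD -natr1 -/t; ring.
have b0 : 0 <= eps / d%:R by rewrite divr_ge0 ?ler0n.
have a0 : 0 <= 1 - eps - eps / d%:R.
  (* Since [d >= 1], the bound [eps <= 1/2] keeps the point mass nonnegative. *)
  have : eps / d%:R <= eps by rewrite ler_pdivrMr ?ltr0n // ler_peMr ?ler1n.
  by lra.
set a := 1 - eps - _ in a0; set b := eps / _ in b0.
have [w [w0 wx wy wd wr]] := class_transport R rr rs rt r_card.
have cE : 1 - eps * ((2 + t%:R) / d%:R) = a + b * #|B x :\: B y|%SET%:R.
  by rewrite DE /a /b; field.
(* The excess mass [a] goes from [x] to [y] along the edge; the uniform part on the ball follows
   [w]. *)
apply: (@wasserstein_eq _ _ _ _ _
   (fun u v => a * ((u == x)%:R * (v == y)%:R) + b * w u v)).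
- split=> [u v|u|v].
  + by rewrite addr_ge0 // mulr_ge0 // mulr_ge0 ?ler0n.
  + rewrite lazy_measureE dx -/a -/b big_split /= -!mulr_sumr wx.
    under eq_bigr do rewrite -[(_ == y)%:R]mulr1.
    by rewrite sum_indicM mulr1.
  + rewrite lazy_measureE dy -/a -/b big_split /= -!mulr_sumr wy.
    by rewrite sum_indicM.
- rewrite cE /transport_cost.
  (* Where [w] is nonzero, the distance is 0 on the diagonal and 1 off it, so the cost of [w] is its
     mass off the diagonal. *)
  have distw u v : (graph_dist e u v)%:R * w u v =
      w u v - (v == u)%:R * w u v.
    have [->|vu] := eqVneq v u; first by
      rewrite graph_dist_refl mul0r mul1r subrr.
    have [ruv|/wr ->] := boolP (r u v); last by rewrite !mulr0 subr0.
    rewrite graph_dist_edge ?r_clique // // 1?eq_sym //.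
    by rewrite !mul1r mul0r subr0.
  transitivity (\sum_u (a * ((u == x)%:R * (graph_dist e u y)%:R)
                 + b * (u \in B x :\: B y)%SET%:R)).
    apply: eq_bigr => u _.
    transitivity (\sum_v
        (a * (u == x)%:R * ((v == y)%:R * (graph_dist e u v)%:R)
         + b * (w u v - (v == u)%:R * w u v))).
      by apply: eq_bigr => v _; rewrite -distw; ring.
    rewrite big_split /= -!mulr_sumr sum_indicM sumrB sum_indicM wx wd.
    rewrite mulrA finset.in_setI finset.in_setD; congr (_ + _ * _).
    by case: (u \in B x); case: (u \in B y); rewrite /= ?subrr ?subr0.
  rewrite big_split /= -!mulr_sumr sum_indicM sum_indic.
  by rewrite graph_dist_edge // mulr1.
- move=> pi' /(transport_cost_ge e (x |: (B x :\: B y))); apply: le_trans.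
  (* [C] lies in [B x], omits [y] and meets [B y] only in [x], so the measures of [C] differ by
     [a + b * #|C| - b]. *)
  set C := (_ |: _)%SET.
  have yC : y \notin C by rewrite !inE !eqxx /= orbF eq_sym.
  have sumC (A : {set T}) (f : T -> R) : (forall v, f v = (v \in A)%:R) ->
      \sum_(v in C) f v = #|C :&: A|%SET%:R.
    move=> fE; rewrite -sum1_card natr_sum big_mkcond [RHS]big_mkcond.
    apply: eq_bigr => v _; rewrite fE finset.in_setI.
    by case: (v \in C); case: (v \in A).
  under eq_bigr do rewrite lazy_measureE.
  under [X in _ <= _ - X]eq_bigr do rewrite lazy_measureE.
  rewrite dx dy -/a -/b !big_split /= -!mulr_sumr.
  rewrite (sumC [set x]%SET) => [|v]; last by rewrite inE.
  rewrite (sumC (B x)) // (sumC [set y]%SET) => [|v]; last by rewrite inE.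
  rewrite (sumC (B y)) //.
  have -> : (C :&: [set x] = [set x])%SET.
    by apply/finset.setIidPr; rewrite finset.sub1set !inE eqxx.
  have -> : (C :&: [set y] = finset.set0)%SET.
    apply/setP => v; rewrite finset.in_setI finset.in_set1 finset.in_set0.
    by case: eqP => [->|_]; rewrite ?andbF // (negPf yC).
  have -> : (C :&: B x = C)%SET.
    apply/finset.setIidPl/fintype.subsetP => v.
    by rewrite !inE => /orP[->//|/andP[]].
  have -> : (C :&: B y = [set x])%SET.
    apply/setP => v; rewrite !inE.
    have [->|_] := eqVneq v x; first by rewrite eyx orbT.
    by case: (_ || e y v) => //=; rewrite andbF.
  rewrite cE !cards1 cards0 cardsU1 !inE eyx orbT /= natrD.
  by lra.
Qed.

Lemma eps_curvature_clique_partition (eps : R) : 0 < eps -> eps <= 2^-1 ->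
  eps_curvature e eps x y / eps =
  (2 + #|common_neighbors e x y|%:R) / d%:R.
Proof.
move=> eps0 eps1.
rewrite /eps_curvature (wasserstein_clique_partition _ (ltW eps0)) //.
rewrite graph_dist_edge // divr1 opprB addrC subrK mulrC mulKf //.
by rewrite gt_eqF.
Qed.

Lemma condensed_ricci_clique_partition :
  cvg (eps_curvature e eps x y / eps @[eps --> (0 : R)^'+]) /\
  condensed_ricci R e x y = (2 + #|common_neighbors e x y|%:R) / d%:R.
Proof.
(* The quotient is constant on [0 < eps <= 1/2], so its limit is that constant. *)
have H : \forall eps \near (0 : R)^'+, eps_curvature e eps x y / eps =
    (2 + #|common_neighbors e x y|%:R) / d%:R.
  near=> eps; apply: eps_curvature_clique_partition.
    by near: eps; apply: nbhs_right_gt.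
  by near: eps; apply: nbhs_right_le; rewrite invr_gt0 ltr0n.
split; first exact: is_cvg_near_cst H.
exact: norm_lim_near_cst H.
Unshelve. all: by end_near. Qed.

End Curvature.

(** * Powers modulo [k] and k-th powers in a finite field *)

Lemma dvdn_geometric_sum (Q k : nat) : prime k -> (Q ^ k = 1 %[mod k])%N ->
  (k %| \sum_(i < k) Q ^ i)%N.
Proof.
move=> kP Qk.
have Q1 : (Q = 1 %[mod k])%N by rewrite -Qk fermat_little.
have : (\sum_(i < k) Q ^ i = \sum_(i < k) 1 %[mod k])%N.
  elim/big_ind2: _ => [//|a b a' b' ab ab'|i _].
    by rewrite -modnDm ab ab' modnDm.
  by rewrite -modnXm Q1 modnXm exp1n.
by rewrite sum1_card card_ord modnn => /eqP.
Qed.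

Section FiniteField.
Variables (F : finFieldType).

(** The nonzero elements are [#|F|.-1] distinct roots of unity of that order, which forces a
    primitive one among them. *)
Lemma finField_prim_root : {z : F | (#|F|.-1).-primitive_root z}.
Proof.
pose rs := [seq x <- enum F | x != 0].
have size_rs : size rs = #|F|.-1.
  by rewrite size_filter -sum1_count big_enum_cond sum1_card -(cardC1 (0 : F)).
have rs1 : all (#|F|.-1).-unity_root rs.
  apply/allP => x; rewrite mem_filter unity_rootE => /andP[x0 _].
  apply/eqP/(mulfI x0); rewrite -exprS prednK ?expf_card ?mulr1 //.
  by apply/card_gt0P; exists x.
have q_gt0 : (0 < #|F|.-1)%N by rewrite -subn1 subn_gt0 finNzRing_gt1.
have /hasP/sig2W[z _ zP] : has (#|F|.-1).-primitive_root rs.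
  by apply: has_prim_root; rewrite ?size_rs // filter_uniq ?enum_uniq.
by exists z.
Qed.

Variables (k d : nat).
Hypothesis cardF : #|F| = (k * d).+1.
Hypothesis d_gt0 : (0 < d)%N.
Hypothesis k_gt0 : (0 < k)%N.

(** Euler's criterion: for [z] primitive and [a = z ^+ i], [a ^+ d = 1] means that [k * d] divides
    [i * d], so [k] divides [i]. *)
Lemma kth_powersP (a : F) : (a \in kth_powers F k) = (a ^+ d == 1).
Proof.
have [z zP] := finField_prim_root; rewrite cardF /= in zP.
apply/imsetP/eqP => [[b]|ad1].
  rewrite inE => b0 ->; rewrite -exprM; apply: (mulfI b0).
  by rewrite -exprS mulr1 -cardF expf_card.
have [i aE] : {i : 'I_(k * d) | a = z ^+ i}.
  by apply: (prim_rootP zP); rewrite mulnC exprM ad1 expr1n.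
have : (k %| i)%N.
  rewrite -(@dvdn_pmul2r d) // (prim_order_dvd zP) exprM -aE; exact/eqP.
case/dvdnP => j ij; exists (z ^+ j); last by rewrite aE ij exprM.
rewrite inE; apply: contra_eqN ad1 => /eqP zj0.
rewrite aE ij exprM zj0 !expr0n !gtn_eqF //= expr0n gtn_eqF //.
by rewrite eq_sym oner_eq0.
Qed.

(** By the criterion these are the d-th roots of unity, that is, the powers of [z ^+ k], which has
    order [d]. *)
Lemma card_kth_powers : #|kth_powers F k| = d.
Proof.
have [z zP] := finField_prim_root; rewrite cardF /= in zP.
have zkP : d.-primitive_root (z ^+ k).
  by have := exp_prim_root zP k; rewrite (gcdn_idPl _) ?dvdn_mulr // mulKn.
rewrite -[RHS]card_ord -(card_imset _ (f := fun i : 'I_d => (z ^+ k) ^+ i)).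
  apply: eq_card => a; rewrite kth_powersP; apply/eqP/imsetP => [ad|[i _ ->]].
    by have [i ->] := prim_rootP zkP ad; exists i.
  by rewrite exprAC (prim_expr_order zkP) expr1n.
move=> i j /eqP; rewrite (eq_prim_root_expr zkP) !modn_small //.
by move/eqP/val_inj.
Qed.

Lemma fixed_kth_power (Q : nat) (a : F) :
  (0 < Q)%N -> (Q.-1 %| d)%N -> a != 0 -> a ^+ Q = a -> a \in kth_powers F k.
Proof.
move=> Q_gt0 /dvdnP[c dE] a0 aQ; rewrite kth_powersP dE mulnC exprM.
have -> : a ^+ Q.-1 = 1 by apply: (mulfI a0); rewrite -exprS prednK // mulr1.
by rewrite expr1n.
Qed.

End FiniteField.

(** * The partition of the Paley graph into cosets of [h * K] *)

Theorem theorem1p10 (R : realType) (F : finFieldType) (p k m q : nat)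
    (m_ge1 : (1 <= m)%N) (k_prime : prime k) (p_prime : prime p)
    (q_def : q = (p ^ (k * m))%N) (q_mod : (q = 1 %[mod 2 * k])%N)
    (card_F : #|F| = q) (x y : F) (xy_edge : gen_paley k x y) :
  cvg (eps_curvature (gen_paley k) eps x y / eps @[eps --> (0 : R)^'+]) /\
  condensed_ricci R (gen_paley k) x y =
    k%:R / (q%:R - 1) * (2 + #|common_neighbors (gen_paley k) x y|%:R).
Proof.
pose Q := (p ^ m)%N.
have Q_gt1 : (1 < Q)%N by rewrite (ltn_exp2l 0) ?prime_gt1.
have Q_gt0 := ltnW Q_gt1.
have qE : q = (Q ^ k)%N by rewrite q_def mulnC expnM.
have k_gt0 := prime_gt0 k_prime.
have [c cE] : exists c, (\sum_(i < k) Q ^ i = c * k)%N.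
  apply/dvdnP/dvdn_geometric_sum => //; rewrite -qE.
  by rewrite -(modn_dvdm q (dvdn_mull 2 (dvdnn k))) q_mod modn_dvdm // dvdn_mull.
(* This is [(q - 1) / k], written so that [Q.-1] visibly divides it. *)
pose d := (Q.-1 * c)%N.
have qd : q = (k * d).+1.
  have q_gt0 : (0 < q)%N by rewrite qE expn_gt0 Q_gt0.
  by rewrite -(prednK q_gt0) qE predn_exp cE /d (mulnC c) mulnCA.
have d_gt0 : (0 < d)%N.
  have : (1 < q)%N by rewrite qE -(exp1n k) ltn_exp2r.
  by rewrite qd; case: (d) => //; rewrite muln0.
have Fd : #|F| = (k * d).+1 by rewrite card_F.
have Qd : (Q.-1 %| d)%N by rewrite dvdn_mulr.
pose K := [pred a : F | a ^+ Q == a].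
(* As [Q] is a power of the characteristic, the Q-th power map is additive, so [K] is an additive
   group. *)
have charF : [pchar F].-nat Q.
  rewrite pnatX; apply/orP; left; rewrite pnatE //.
  by apply: (card_finPcharP (n := k * m)); rewrite // card_F.
have K0 : 0 \in K by rewrite inE expr0n gtn_eqF.
have K1 : 1 \in K by rewrite inE expr1n.
have KN a : a \in K -> - a \in K by rewrite !inE exprNn_pchar // => /eqP ->.
have KD a b : a \in K -> b \in K -> a + b \in K.
  by rewrite !inE exprDn_pchar // => /eqP -> /eqP ->.
have KH (a : F) : a != 0 -> a \in K -> a \in kth_powers F k.
  by move=> a0 /eqP; apply: fixed_kth_power Fd _ _ _ _ _ _ _.
pose h := x - y.
have hH : h \in kth_powers F k by exact: xy_edge.
have HP := kth_powersP F k d Fd d_gt0 k_gt0.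
have h0 : h != 0.
  by apply: contraTneq hH => ->; rewrite HP expr0n gtn_eqF // eq_sym oner_eq0.
have HM a b : a \in kth_powers F k -> b \in kth_powers F k ->
    a * b \in kth_powers F k.
  by rewrite !HP exprMn => /eqP -> /eqP ->; rewrite mulr1.
(* [-1] lies in [K], hence is a k-th power; this makes adjacency symmetric. *)
have HN a : a \in kth_powers F k -> - a \in kth_powers F k.
  by rewrite -mulN1r; apply: HM; rewrite KH ?KN // oppr_eq0 oner_eq0.
pose r : rel F := fun u v => (u - v) / h \in K.
have card_nb (z : F) : #|neighbors (gen_paley k) z| = d.
  rewrite -(card_kth_powers F k d Fd d_gt0 k_gt0).
  rewrite -(card_imset (kth_powers F k) (subrI z)).
  apply: eq_card => a; rewrite inE.
  apply/idP/imsetP => [za|[b bH ->]].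
    by exists (z - a); rewrite // opprB addrC subrK.
  by rewrite /gen_paley opprB addrC subrK.
have e_irr : irreflexive (gen_paley k : rel F).
  by move=> u; rewrite /gen_paley subrr HP expr0n gtn_eqF // eq_sym oner_eq0.
have eyx : gen_paley k y x by rewrite /gen_paley -opprB HN.
have rr : reflexive r by move=> u; rewrite /r subrr mul0r.
have rs1 (u v : F) : r u v -> r v u by rewrite /r -(opprB u v) mulNr; apply: KN.
have rs : symmetric r by move=> u v; apply/idP/idP; apply: rs1.
have rt : transitive r.
  by move=> v u w uv /(KD _ _ uv); rewrite -mulrDl addrA subrK.
(* [u - v] is [h] times a nonzero element of [K]: a product of two k-th powers. *)
have r_clique (u v : F) : u != v -> r u v -> gen_paley k u v.
  move=> uv ruv; rewrite /gen_paley -(divfK h0 (u - v)); apply: HM => //.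
  by apply: KH => //; rewrite mulf_neq0 ?invr_eq0 // subr_eq0.
have r_card (u : F) :
    #|[set v in x |: neighbors (gen_paley k) x | r u v]%SET| =
    #|[set v in y |: neighbors (gen_paley k) y | r u v]%SET|.
  (* Translation by [- h] takes [x] to [y], and keeps each class because [h / h = 1] is in [K]. *)
  rewrite -(card_imset _ (addIr (- h))).
  have shift (v : F) :
      (v \in [set v in x |: neighbors (gen_paley k) x | r u v]%SET) =
      (v - h \in [set v in y |: neighbors (gen_paley k) y | r u v]%SET).
    rewrite !inE subr_eq (_ : y + h = x); last by rewrite addrC subrK.
    rewrite /r /gen_paley (_ : y - (v - h) = x - v); last by rewrite /h; ring.
    rewrite (_ : (u - (v - h)) / h = (u - v) / h + 1); last by field.
    congr (_ && _); apply/idP/idP => [/KD|/KD/(_ (KN _ K1))]; first exact.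
    by rewrite addrK.
  apply: eq_card => v; apply/imsetP/idP => [[w wA ->]|vA].
    by rewrite -shift.
  by exists (v + h); rewrite ?shift addrK.
have [cvgk ->] := condensed_ricci_clique_partition R F (gen_paley k) r x y d
  e_irr xy_edge eyx (card_nb x) (card_nb y) rr rs rt r_clique r_card.
split=> //; rewrite qd.
have -> : (k * d).+1%:R - 1 = k%:R * d%:R :> R by rewrite -natr1 addrK natrM.
by field; rewrite !pnatr_eq0 -!lt0n d_gt0 k_gt0.
Qed.
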